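(* Let $\mathbb{K}\in\{\mathbb{R},\mathbb{C}\}$, let $(X,\langle\cdot|\cdot\rangle)$ be a non-trivial $\mathbb{K}$-Hilbert space with induced norm $\|\cdot\|$, and let $M\subset X$ be a Hilbert basis. For $\xi,\eta\in X$ put $M(\xi):=\{e\in M:\langle e|\xi\rangle\neq 0\}$, $M(\eta):=\{e\in M:\langle e|\eta\rangle\neq 0\}$ and $$\xi*\eta:=\sum_{e\in M(\xi)\cap M(\eta)}\langle e|\xi\rangle\,\langle e|\eta\rangle\, e ,$$ where the sum over the empty set is $0_X$. Then this defines a bilinear, commutative and associative map $*:X^2\to X$, $(\xi,\eta)\mapsto \xi*\eta$, such that $$\|\xi*\eta\|\leqslant\|\xi\|\cdot\|\eta\|\qquad\text{for all }\xi,\eta\in X,$$ and, as a consequence, $(X,+,\cdot,*,\|\cdot\|)$ is a commutative Banach algebra.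
   Context: A Hilbert basis is a complete orthonormal system (maximal orthonormal subset), not necessarily countable. The inner product $\langle\cdot|\cdot\rangle$ is conjugate-linear in the first argument and linear in the second argument. A Banach algebra is not required to have a unit. *)

(* Defs.v *)
From HB Require Import structures.
From mathcomp Require Import all_boot all_order all_algebra.
From mathcomp Require Import all_classical all_reals all_analysis.
From mathcomp Require Import sesquilinear complex summability.

Set Implicit Arguments.
Unset Strict Implicit.
Unset Printing Implicit Defensive.

Import Order.TTheory GRing.Theory Num.Theory.
Import numFieldNormedType.Exports.

Local Open Scope classical_set_scope.
Local Open Scope ring_scope.

Inductive scalar_kind := RealScalars | ComplexScalars.

Definition scalars (R : realType) (k : scalar_kind) : numFieldType :=
  match k with
  | RealScalars => R
  | ComplexScalars => R[i]%C
  end.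

Definition scalar_conj (R : realType) (k : scalar_kind) :
    {rmorphism scalars R k -> scalars R k} :=
  match k with
  | RealScalars => idfun
  | ComplexScalars => @conjc R
  end.

Section Hilbert.
Context {K : numFieldType} {theta : {rmorphism K -> K}}.
Context {X : completeNormedModType K}.
Implicit Types (ip : {dot X for theta}) (M : set X) (x y : X).

(* [{dot X for theta}] is linear in its first argument and [theta]-linear in
   its second one; the physicists' bracket <x|y>, conjugate-linear in the first
   argument and linear in the second one, is obtained by swapping. *)
Definition bracket ip x y : K := ip y x.

Definition induces_norm ip : Prop := forall x, `|x| ^+ 2 = bracket ip x x.

Definition orthonormal_system ip M : Prop :=
  forall e f, M e -> M f -> bracket ip e f = (e == f)%:R.

Definition hilbert_basis ip M : Prop :=
  orthonormal_system ip M /\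
  forall N : set X, orthonormal_system ip N -> M `<=` N -> N = M.

Definition bracket_support ip M x : set X := [set e | M e /\ bracket ip e x != 0].

Definition hprod_index ip M x y : set X :=
  bracket_support ip M x `&` bracket_support ip M y.

Definition hprod_term ip M x y (e : hprod_index ip M x y) : X :=
  (bracket ip (val e) x * bracket ip (val e) y) *: val e.

(* The sum over a possibly infinite index set is unordered: [sum u] is the
   limit of the finite partial sums [partial_sum u] along the directed set
   [totally] of finite subsets of the index type, and is meaningful only when
   they converge. *)
Definition hprod_summable ip M x y : Prop :=
  cvg (partial_sum (@hprod_term ip M x y) @ totally).

Definition hprod ip M x y : X := sum (@hprod_term ip M x y).

End Hilbert.

(* Completeness is part of the type of [X]; no unit is required. *)
Record commutative_banach_algebra (K : numFieldType)
    (X : completeNormedModType K) (mul : X -> X -> X) : Prop :=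
  CommutativeBanachAlgebra {
    cba_bilinear : bilinear_for *:%R *:%R mul ;
    cba_associative : associative mul ;
    cba_commutative : commutative mul ;
    cba_norm_le : forall x y : X, `|mul x y| <= `|x| * `|y|
  }.

(* Main.v *)
(* Everything is read off coefficients: maximality of [M] makes a vector
   determined by its coefficients <e|x>, e in M, and xi * eta is the vector
   whose coefficients are the products <e|xi><e|eta>, so the algebraic laws are
   those of the scalars.  Bessel's inequality, together with
   |<e|eta>| <= |eta|, bounds the sum of |<e|xi><e|eta>|^2 over every finite
   part of [M] by (|xi||eta|)^2.  Hence the partial sums are Cauchy: otherwise
   infinitely many disjoint finite blocks of squared norm at least eps^2 would
   exceed this bound, by the archimedean property of the scalars; and the same
   bound passes to the norm of the limit. *)

Require Import Defs.
From HB Require Import structures.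
From mathcomp Require Import all_boot all_order all_algebra.
From mathcomp Require Import all_classical all_reals all_analysis.
From mathcomp Require Import sesquilinear complex summability.
From mathcomp Require Import finmap.

Set Implicit Arguments.
Unset Strict Implicit.
Unset Printing Implicit Defensive.

Import Order.TTheory GRing.Theory Num.Theory.
Import numFieldNormedType.Exports.

Local Open Scope classical_set_scope.
Local Open Scope ring_scope.

(* The library declares this instance inside a section, where it is lost. *)
#[local] Existing Instance totally_filter.

Lemma partial_sumE (I : choiceType) (V : zmodType) (u : I -> V) (A : {fset I}) :
  partial_sum u A = \sum_(i <- A) u i.
Proof. by rewrite big_seq_fsetE. Qed.

Lemma bounded_sum_tail (K : numFieldType) (I : eqType) (f : I -> K) (C : K) :
  (forall x : K, exists n : nat, `|x| < n%:R) ->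
  (forall i, 0 <= f i) ->
  (forall s, uniq s -> \sum_(i <- s) f i <= C) ->
  forall eps, 0 < eps -> exists2 s, uniq s &
    forall t, uniq t -> ~~ has (mem s) t -> \sum_(i <- t) f i < eps.
Proof.
move=> arch f0 fC eps eps0; apply: contrapT => nP.
have step s : uniq s ->
    exists t, [/\ uniq t, ~~ has (mem s) t & eps <= \sum_(i <- t) f i].
  move=> us; apply: contrapT => nt; apply: nP; exists s => // t ut st.
  have sum0 : 0 <= \sum_(i <- t) f i by exact: sumr_ge0.
  (* The order of [K] is only partial; negating [<] is legitimate because both sides are
     nonnegative, hence real. *)
  rewrite real_ltNge ?(gtr0_real eps0) ?(ger0_real sum0)//.
  by apply/negP => et; apply: nt; exists t.
have grow n : exists2 s, uniq s & eps *+ n <= \sum_(i <- s) f i.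
  elim: n => [|n IHn]; first by exists [::]; rewrite ?big_nil.
  case: IHn => r ur rn; have [t [ut st et]] := step r ur; exists (r ++ t).
    by rewrite cat_uniq ur ut st.
  by rewrite big_cat mulrSr lerD.
(* [m] blocks give [eps *+ m <= C] although [C / eps < m]. That [C / eps] is real follows from
   [0 <= C], obtained once [C] is seen to dominate [eps *+ m]. *)
have [m /(le_lt_trans (real_ler_norm _))] := arch (C / eps).
have [s us sn] := grow m; have eC := le_trans sn (fC s us).
have C0 : 0 <= C by apply: le_trans eC; rewrite mulrn_wge0// ltW.
rewrite ger0_real ?divr_ge0 ?(ltW eps0)// => /(_ isT).
by rewrite ltr_pdivrMr// mulr_natl => /(le_lt_trans eC); rewrite ltxx.
Qed.

Section Hilbert.
Context {K : numFieldType} {theta : {rmorphism K -> K}}.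
Hypothesis thetaP : forall a : K, a * theta a = `|a| ^+ 2.
Hypothesis arch : forall x : K, exists n : nat, `|x| < n%:R.
Context {X : completeNormedModType K}.
Variable ip : {dot X for theta}.
Hypothesis ip_norm : induces_norm ip.

Lemma ip_suml (I : Type) (s : seq I) (a : I -> K) (e : I -> X) (x : X) :
  ip (\sum_(i <- s) a i *: e i) x = \sum_(i <- s) a i * ip (e i) x.
Proof.
rewrite linear_sumlz; apply: eq_bigr => i _; exact: (linearZl_LR ip).
Qed.

Lemma ip_sumr (I : Type) (s : seq I) (a : I -> K) (e : I -> X) (x : X) :
  ip x (\sum_(i <- s) a i *: e i) = \sum_(i <- s) theta (a i) * ip x (e i).
Proof.
rewrite linear_sumr; apply: eq_bigr => i _; exact: (linearZr_LR ip).
Qed.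

Lemma ipBl (x y z : X) : ip (x - y) z = ip x z - ip y z.
Proof. exact: (linearBl ip). Qed.

Lemma ipBr (x y z : X) : ip x (y - z) = ip x y - ip x z.
Proof. exact: (linearBr ip). Qed.

Lemma ipC (x y : X) : ip x y = theta (ip y x).
Proof. by rewrite hermC mul1r. Qed.

(** * Orthonormal families: Bessel's inequality and summability *)

Section Orthonormal.
Context {I : choiceType} (e : I -> X).
Hypothesis e_orth : forall i j, ip (e i) (e j) = (i == j)%:R.

Lemma ip_sum_orthonormal (s : seq I) (a : I -> K) (j : I) : uniq s ->
  ip (\sum_(i <- s) a i *: e i) (e j) = if j \in s then a j else 0.
Proof.
move=> us; rewrite ip_suml.
case: ifPn => js.
  rewrite (bigD1_seq j)//= e_orth eqxx mulr1 big1 ?addr0// => i ij.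
  by rewrite e_orth (negbTE ij) mulr0.
rewrite big_seq big1// => i i_s; rewrite e_orth.
by case: eqP => [ij|]; rewrite ?mulr0//; rewrite -ij i_s in js.
Qed.

Lemma norm_sum_orthonormal (s : seq I) (a : I -> K) : uniq s ->
  `|\sum_(i <- s) a i *: e i| ^+ 2 = \sum_(i <- s) `|a i| ^+ 2.
Proof.
move=> us; rewrite ip_norm /bracket ip_sumr [LHS]big_seq [RHS]big_seq.
apply: eq_bigr => i i_s.
by rewrite ip_sum_orthonormal// i_s mulrC thetaP.
Qed.

Lemma bessel (s : seq I) (x : X) : uniq s ->
  \sum_(i <- s) `|ip x (e i)| ^+ 2 <= `|x| ^+ 2.
Proof.
move=> us; set B := \sum_(i <- s) _.
(* [S] is the orthogonal projection of [x] onto the span of the [e i]; Bessel's inequality is the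
   nonnegativity of the squared norm of [x - S], which equals [ip x x - B]. *)
pose S := \sum_(i <- s) ip x (e i) *: e i.
have xS : ip x S = B.
  by rewrite ip_sumr; apply: eq_bigr => i _; rewrite mulrC thetaP.
have Sx : ip S x = B.
  by rewrite ip_suml; apply: eq_bigr => i _; rewrite (ipC (e i)) thetaP.
have SS : ip S S = B by have := ip_norm S; rewrite norm_sum_orthonormal.
rewrite ip_norm /bracket -subr_ge0.
have -> : ip x x - B = ip (x - S) (x - S).
  by rewrite ipBl !ipBr xS Sx SS subrr subr0.
by have := ip_norm (x - S); rewrite /bracket => <-; rewrite exprn_ge0.
Qed.

Lemma sum_prod_coef_le (s : seq I) (x y : X) : uniq s ->
  \sum_(i <- s) `|ip x (e i) * ip y (e i)| ^+ 2 <= (`|x| * `|y|) ^+ 2.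
Proof.
move=> us; rewrite exprMn.
apply: le_trans (_ : \sum_(i <- s) `|ip x (e i)| ^+ 2 * `|y| ^+ 2 <= _).
  apply: ler_sum => i _; rewrite normrM exprMn ler_wpM2l ?exprn_ge0//.
  (* Bessel for a single index bounds the coefficient of [y] by its norm. *)
  have := @bessel [:: i] y isT; by rewrite big_seq1.
by rewrite -mulr_suml ler_wpM2r ?exprn_ge0// bessel.
Qed.

Lemma orthonormal_summable (a : I -> K) (C : K) :
  (forall s, uniq s -> \sum_(i <- s) `|a i| ^+ 2 <= C) ->
  cvg (partial_sum (fun i => a i *: e i) @ totally).
Proof.
move=> aC; have a0 i : 0 <= `|a i| ^+ 2 by rewrite exprn_ge0.
apply: cauchy_cvg; apply: cauchy_exP => eps eps0.
have [s us tail] := bounded_sum_tail arch a0 aC (exprn_gt0 2 eps0).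
(* The partial sum over [s] is the centre of the Cauchy ball: for a finite [B] containing [s], the
   difference is the sum over [B] minus [s], whose squared norm is below [eps ^+ 2]. *)
exists (\sum_(i <- s) a i *: e i).
exists [fset i in s]%fset => // B /fsubsetP sB.
have {}sB : {subset s <= B} by move=> i i_s; apply: sB; rewrite inE.
rewrite -ball_normE /= distrC partial_sumE.
have Bs : perm_eq [seq i <- B | i \in s] s.
  apply: uniq_perm => //; first exact: filter_uniq.
  by move=> i; rewrite mem_filter andb_idr// => /sB.
rewrite (bigID (mem s)) /= -big_filter (perm_big _ Bs) /= addrAC subrr add0r.
rewrite -big_filter -(ltr_pXn2r (ltn0Sn 1)) ?nnegrE ?(ltW eps0)//.
rewrite norm_sum_orthonormal ?filter_uniq//.
apply: tail; first exact: filter_uniq.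
by apply/hasPn => i; rewrite mem_filter => /andP[].
Qed.

Lemma norm_orthonormal_sum_le (a : I -> K) (C : K) : 0 <= C ->
  (forall s, uniq s -> \sum_(i <- s) `|a i| ^+ 2 <= C ^+ 2) ->
  `|sum (fun i => a i *: e i)| <= C.
Proof.
move=> C0 aC; have /cvgrPdist_lt cv := orthonormal_summable aC.
apply/ler_addgt0Pr => eps eps0.
have [A _ /(_ A (fsubset_refl A)) /= leps] := cv _ eps0.
rewrite -(subrK (partial_sum (fun i => a i *: e i) A) (sum _)).
rewrite addrC (le_trans (ler_normD _ _))// lerD ?(ltW leps)//.
rewrite -(ler_pXn2r (ltn0Sn 1)) ?nnegrE// partial_sumE.
by rewrite norm_sum_orthonormal// aC.
Qed.

End Orthonormal.

(** Pairing with a unit vector [v] is 1-Lipschitz, so it passes to the limit. *)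
Lemma ip_sum_limit (I : choiceType) (u : I -> X) (v : X) (c : K) :
  ip v v = 1 -> cvg (partial_sum u @ totally) ->
  (\forall A \near totally, ip (partial_sum u A) v = c) ->
  ip (sum u) v = c.
Proof.
move=> v1 /cvgrPdist_lt cv uc; apply/eqP; rewrite -subr_eq0 -normr_le0.
apply/ler_addgt0Pr => eps eps0; rewrite add0r; apply: ltW.
have [A [lA <-]] : exists A, `|sum u - partial_sum u A| < eps /\
    ip (partial_sum u A) v = c.
  exact: filter_ex (filterI (cv _ eps0) uc).
rewrite -ipBl; apply: le_lt_trans lA.
rewrite -(ler_pXn2r (ltn0Sn 1)) ?nnegrE//.
(* A unit vector is an orthonormal family indexed by [unit]; Bessel then yields the Lipschitz
   bound. *)
have := @bessel _ (fun=> v) _ [:: tt] (sum u - partial_sum u A) isT.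
by rewrite big_seq1; apply => -[] [].
Qed.

(** * Coefficients with respect to the Hilbert basis and the algebraic laws *)

Section Basis.
Variable M : set X.
Hypothesis M_basis : hilbert_basis ip M.

Let M_orth : orthonormal_system ip M := M_basis.1.

Lemma ip_basis (e f : X) : M e -> M f -> ip e f = (e == f)%:R.
Proof. by move=> Me Mf; rewrite -[LHS]/(bracket ip f e) M_orth// eq_sym. Qed.

(* A nonzero vector orthogonal to [M] could be normalized and added to [M],
   against maximality. *)
Lemma basis_separates (x y : X) :
  (forall e, M e -> ip x e = ip y e) -> x = y.
Proof.
move=> xy; apply/eqP; rewrite -subr_eq0; apply: contrapT => /negP z0.
set z := x - y in z0.
have zM e : M e -> ip z e = 0 by move=> Me; rewrite ipBl xy ?subrr.
have nz : `|z| != 0 by rewrite normr_eq0.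
pose w := `|z|^-1 *: z.
have wM e : M e -> ip w e = 0.
  by move=> Me; rewrite (linearZl_LR ip) /= zM ?mulr0.
have w1 : ip w w = 1.
  rewrite -[LHS]/(bracket ip w w) -ip_norm normrZ normfV normr_id mulVf//.
  by rewrite expr1n.
have Mw e : M e -> ip e w = 0 by move=> Me; rewrite ipC wM// rmorph0.
suff MwM : M w.
  by move: w1; rewrite wM// => /esym/eqP; rewrite oner_eq0.
rewrite -(M_basis.2 (M `|` [set w])).
- by right.
- have neq e : M e -> (e == w) = false.
    move=> Me; apply/eqP => ew; move: (wM _ Me); rewrite -{1}ew.
    by rewrite ip_basis// eqxx => /eqP; rewrite oner_eq0.
  move=> e f [Me|->] [Mf|->]; rewrite /bracket.
  + by rewrite ip_basis// eq_sym.
  + by rewrite wM// neq.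
  + by rewrite Mw// eq_sym neq.
  + by rewrite w1 eqxx.
- by move=> e; left.
Qed.

Section Product.
Variables x y : X.

Lemma hprod_index_orthonormal (i j : hprod_index ip M x y) :
  ip (val i) (val j) = (i == j)%:R.
Proof.
have Mi (k : hprod_index ip M x y) : M (val k) by case: (set_valP k) => -[].
by rewrite ip_basis.
Qed.

Lemma hprod_coef_bound (s : seq (hprod_index ip M x y)) : uniq s ->
  \sum_(i <- s) `|bracket ip (val i) x * bracket ip (val i) y| ^+ 2
    <= (`|x| * `|y|) ^+ 2.
Proof. exact: sum_prod_coef_le hprod_index_orthonormal _ x y. Qed.

Lemma hprod_cvg : hprod_summable ip M x y.
Proof.
exact: orthonormal_summable hprod_index_orthonormal _ _ hprod_coef_bound.
Qed.

Lemma norm_hprod_le : `|hprod ip M x y| <= `|x| * `|y|.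
Proof.
apply: norm_orthonormal_sum_le hprod_index_orthonormal _ _ _ hprod_coef_bound.
exact: mulr_ge0.
Qed.

Lemma ip_hprod (e : X) : M e -> ip (hprod ip M x y) e = ip x e * ip y e.
Proof.
move=> Me; apply: ip_sum_limit hprod_cvg _.
  by rewrite ip_basis// eqxx.
have [ixy|nixy] := pselect (hprod_index ip M x y e).
  (* Once a finite index set contains [e], its partial sum already has the required coefficient. *)
  pose i : hprod_index ip M x y := SigSub (mem_set ixy).
  exists [fset i]%fset => // A; rewrite /= fsub1set => iA.
  rewrite partial_sumE /hprod_term.
  rewrite (@ip_sum_orthonormal _ val hprod_index_orthonormal A _ i) ?iA//.
(* If [e] is not an index, every partial sum is orthogonal to [e], and one of the two coefficients
   at [e] vanishes. *)
exists fset0 => // A _ /=.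
rewrite partial_sumE /hprod_term ip_suml big1 => [|i _].
  apply/esym/eqP; rewrite mulf_eq0; apply: contrapT => /negP.
  by rewrite negb_or => /andP[x0 y0]; apply: nixy.
have Ii := set_valP i; have [[Mi _] _] := Ii.
rewrite ip_basis//; case: eqP => [ie|]; last by rewrite mulr0.
by case: nixy; rewrite -ie.
Qed.

End Product.

Lemma hprodC : commutative (hprod ip M).
Proof.
by move=> x y; apply: basis_separates => e Me; rewrite !ip_hprod// mulrC.
Qed.

Lemma hprodA : associative (hprod ip M).
Proof.
by move=> x y z; apply: basis_separates => e Me; rewrite !ip_hprod// mulrA.
Qed.

Lemma hprod_linearr (x : X) : linear (hprod ip M x).
Proof.
move=> a y z; apply: basis_separates => e Me.
rewrite (linearPl ip) /= !ip_hprod// (linearPl ip) /=.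
by rewrite mulrDr mulrCA.
Qed.

Lemma hprod_bilinear : bilinear_for *:%R *:%R (hprod ip M).
Proof.
split=> x; last exact: hprod_linearr.
by move=> a y z; rewrite !(hprodC _ x) hprod_linearr.
Qed.

End Basis.

End Hilbert.

(** * Both scalar fields satisfy the assumptions [thetaP] and [arch] *)

Lemma scalars_conjP (R : realType) (k : scalar_kind) (a : scalars R k) :
  a * scalar_conj R k a = `|a| ^+ 2.
Proof.
case: k a => a /=; last by rewrite sqr_normc.
by rewrite real_normK ?num_real// expr2.
Qed.

Lemma scalars_archimedean (R : realType) (k : scalar_kind) (a : scalars R k) :
  exists n : nat, `|a| < n%:R.
Proof.
case: k a => a /=; first by exists (Num.bound `|a|); exact: archi_boundP (normr_ge0 _).
exists (Num.bound (complex.Re `|a|)).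
(* The modulus is an element of [R[i]]; being real, it comes from some [r] in [R], where the
   archimedean bound applies. *)
have /complex_realP[r ar] : `|a| \is Num.real by exact: normr_real.
rewrite ar /= -(rmorph_nat (@real_complex R)) ltcR.
apply: archi_boundP; rewrite -lecR -ar; exact: normr_ge0.
Qed.

Theorem theorem1 (R : realType) (k : scalar_kind)
    (X : completeNormedModType (scalars R k))
    (ip : {dot X for scalar_conj R k}) (M : set X)
    (ip_norm : induces_norm ip)
    (X_nontrivial : exists x : X, x != 0)
    (M_basis : hilbert_basis ip M) :
  (forall xi eta : X, hprod_summable ip M xi eta) /\
  bilinear_for *:%R *:%R (hprod ip M) /\
  commutative (hprod ip M) /\
  associative (hprod ip M) /\
  (forall xi eta : X, `|hprod ip M xi eta| <= `|xi| * `|eta|) /\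
  commutative_banach_algebra (hprod ip M).
Proof.
have thetaP := @scalars_conjP R k; have arch := @scalars_archimedean R k.
have bil := hprod_bilinear thetaP arch ip_norm M_basis.
have comm := hprodC thetaP arch ip_norm M_basis.
have assoc := hprodA thetaP arch ip_norm M_basis.
have le := norm_hprod_le thetaP arch ip_norm M_basis.
split; first exact: (@hprod_cvg _ _ thetaP arch _ _ ip_norm _ M_basis).
by do 4!split=> //.
Qed.
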